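(* Let $(X,c)$ and $(Y,d)$ be fuzzy closure spaces and let $\theta:X\to Y$ be a function. Then $\theta:(X,c)\to(Y,d)$ is ČF-continuous if and only if it is ČF-continuous at every fuzzy point of $X$.
   Context: $I=[0,1]$; a fuzzy (sub)set of a non-empty set $X$ is a map $f:X\to I$, and $I^X$ is the set of all of them, ordered pointwise ($f\le g$ iff $f(x)\le g(x)$ for all $x$), with $\vee,\wedge$ pointwise supremum/infimum. $\underline 0$ is the constant $0$ fuzzy set. For $x\in X$ and $0<\lambda\le 1$, the fuzzy point $x_\lambda$ is the fuzzy set with value $\lambda$ at $x$ and $0$ elsewhere; $x_\lambda\in f$ means $x_\lambda\le f$, i.e. $\lambda\le f(x)$. A fuzzy closure space is a pair $(X,c)$ with $X$ a non-empty set and $c:I^X\to I^X$ satisfying $c(\underline 0)=\underline 0$, $f\le c(f)$, and $c(f\vee g)=c(f)\vee c(g)$ for all $f,g\in I^X$ (idempotency is not required). For $\theta:X\to Y$ and $f\in I^X$, $\theta(f)\in I^Y$ is given by $\theta(f)(y)=\sup\{f(x):\theta(x)=y\}$ if $\theta^{-1}(y)\ne\emptyset$, and $0$ otherwise. $\theta:(X,c)\to(Y,d)$ is ČF-continuous if $\theta(c(f))\le d(\theta(f))$ for all $f\in I^X$. $\theta$ is ČF-continuous at a fuzzy point $x_\lambda$ of $X$ if for every $f\in I^X$ with $x_\lambda\in c(f)$ one has $\theta(x_\lambda)\le d(\theta(f))$. *)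

(* Defs.v *)
From mathcomp Require Import all_boot all_order all_algebra.
From mathcomp Require Import interval_inference.
From mathcomp Require Import boolp classical_sets reals.
Set Implicit Arguments.
Unset Strict Implicit.
Unset Printing Implicit Defensive.
Import Order.TTheory GRing.Theory Num.Theory.
Local Open Scope classical_set_scope.
Local Open Scope ring_scope.

(* [{i01 R}] is the unit interval. Functions [X -> {i01 R}] carry the pointwise
   order [(f <= g)%O] and join [(f `|` g)%O] of boolp (see [lefP], [joinfE]). *)
Definition fuzzy_set (R : realType) (X : Type) : Type := X -> {i01 R}.

Definition fuzzy0 (R : realType) (X : Type) : fuzzy_set R X := fun=> 0%:i01.

Definition fuzzy_point (R : realType) (X : Type) (x : X) (lambda : {i01 R}) :
    fuzzy_set R X :=
  fun z => if `[< z = x >] then lambda else 0%:i01.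

Record fuzzy_closure_space (R : realType) (X : Type)
    (c : fuzzy_set R X -> fuzzy_set R X) : Prop := {
  fcs_inhabited : inhabited X ;
  fcs_closure0 : c (@fuzzy0 R X) = @fuzzy0 R X ;
  fcs_closure_ext : forall f, (f <= c f)%O ;
  fcs_closureU : forall f g, c (f `|` g)%O = (c f `|` c g)%O }.

(* The supremum is taken in [{i01 R}]; [supremum x0 A] is [x0] when [A] is
   empty, which gives the value 0 outside the range of [theta]. *)
Definition fuzzy_image (R : realType) (X Y : Type) (theta : X -> Y)
    (f : fuzzy_set R X) : fuzzy_set R Y :=
  fun y => supremum (0%:i01 : {i01 R}) [set f x | x in [set x | theta x = y]].

Definition CF_continuous (R : realType) (X Y : Type)
    (c : fuzzy_set R X -> fuzzy_set R X)
    (d : fuzzy_set R Y -> fuzzy_set R Y) (theta : X -> Y) : Prop :=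
  forall f, (fuzzy_image theta (c f) <= d (fuzzy_image theta f))%O.

(* [p] is meant to be a fuzzy point. *)
Definition CF_continuous_at (R : realType) (X Y : Type)
    (c : fuzzy_set R X -> fuzzy_set R X)
    (d : fuzzy_set R Y -> fuzzy_set R Y) (theta : X -> Y)
    (p : fuzzy_set R X) : Prop :=
  forall f, (p <= c f)%O ->
    (fuzzy_image theta p <= d (fuzzy_image theta f))%O.

(* Main.v *)
Require Import Defs.
From mathcomp Require Import all_boot all_order all_algebra.
From mathcomp Require Import interval_inference.
From mathcomp Require Import boolp classical_sets reals.
Local Open Scope ring_scope.
Import Order.TTheory GRing.Theory Num.Theory.
Local Open Scope classical_set_scope.

(** Taking images along [theta] is left adjoint to precomposition with [theta].
    Hence both continuity conditions can be read in [X]: the global one says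
    [c f x <= d (theta f) (theta x)] for all [f] and [x], and the one at
    [x_lambda] says that [lambda <= c f x] implies
    [lambda <= d (theta f) (theta x)]. They are equivalent on taking
    [lambda = c f x], the case [c f x = 0] being trivial. *)

Lemma i01_ge0 {R : realType} (a : {i01 R}) : (0%:i01 <= a)%O.
Proof. by rewrite -num_le/=. Qed.

(** The real supremum of the values is at least 0, thanks to any element of [A], and at most 1, so
    it lifts to [{i01 R}]. *)
Lemma i01_supremums_neq0 {R : realType} {A : set {i01 R}} :
  A !=set0 -> supremums A !=set0.
Proof.
move=> [a Aa]; pose B : set R := [set u%:num | u in A].
have B0 : B !=set0 by exists a%:num, a.
have ubB1 : ubound B 1 by move=> _ [u _ <-].
have leB (u : {i01 R}) : A u -> u%:num <= sup B.
  by move=> Au; apply: ub_le_sup; [exists 1 | exists u].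
have s0 : 0 <= sup B by apply: le_trans (leB a Aa).
have s1 : sup B <= 1 by exact: ge_sup.
exists (Itv01 s0 s1 : {i01 R}); split=> [u Au|b ubAb]; rewrite -num_le/=.
  exact: leB.
by apply: ge_sup => // _ [u Au <-]; rewrite num_le; exact: ubAb.
Qed.

(** The default value 0 is the least element of [{i01 R}], so it is also the true supremum of the
    empty set. *)
Lemma supremum_i01_leP {R : realType} (A : set {i01 R}) (b : {i01 R}) :
  (supremum (0%:i01 : {i01 R}) A <= b)%O <-> ubound A b.
Proof.
have [->|/set0P A0] := eqVneq A set0.
  by rewrite supremum0; split=> [_ u []|_]; exact: i01_ge0.
have supA := i01_supremums_neq0 A0; split=> [leb u Au|ubAb].
  exact: le_trans (ge_supremum_Nmem _ supA Au) leb.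
rewrite /supremum ifF; last exact/negbTE/set0P.
(* [supremum] picks some element of [supremums A]; the witness [s] rules out the default. *)
by case: supA => s sA; case: xgetP => [t _ [_ least_t]|/(_ s)//]; exact: least_t.
Qed.

Lemma fuzzy_image_leP {R : realType} {X Y : Type} (theta : X -> Y)
    (f : fuzzy_set R X) (g : fuzzy_set R Y) :
  (fuzzy_image theta f <= g)%O <-> (forall x, (f x <= g (theta x))%O).
Proof.
split=> [/lefP le_fg x|le_fg].
  by have /supremum_i01_leP := le_fg (theta x); apply; exists x.
by apply/lefP => y; apply/supremum_i01_leP => _ [x <- <-].
Qed.

(** Away from [x] the fuzzy point is 0, so only [z = x] constrains [g]. *)
Lemma fuzzy_point_comp_leP {R : realType} {X Y : Type} (theta : X -> Y)
    (x : X) (lambda : {i01 R}) (g : fuzzy_set R Y) :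
  (forall z, (fuzzy_point x lambda z <= g (theta z))%O) <->
  (lambda <= g (theta x))%O.
Proof.
split=> [/(_ x)|le_g z]; rewrite /fuzzy_point; first by rewrite asboolT.
by case: asboolP => [->//|_]; exact: i01_ge0.
Qed.

Theorem theorem3p2 (R : realType) (X Y : Type)
    (c : fuzzy_set R X -> fuzzy_set R X)
    (d : fuzzy_set R Y -> fuzzy_set R Y)
    (hc : fuzzy_closure_space c) (hd : fuzzy_closure_space d)
    (theta : X -> Y) :
  CF_continuous c d theta <->
  (forall (x : X) (lambda : {i01 R}), 0 < lambda%:num ->
     CF_continuous_at c d theta (fuzzy_point x lambda)).
Proof.
split=> [cont x lambda _ f /lefP le_cf|cont f].
  apply/fuzzy_image_leP => z; apply: le_trans (le_cf z) _.
  by move: z; apply/fuzzy_image_leP; exact: cont.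
apply/fuzzy_image_leP => x.
have [cfx0|] := leP (c f x)%:num 0.
  by apply: le_trans (i01_ge0 _); rewrite -num_le.
move=> /(cont x) /(_ f) cont_x.
apply/(fuzzy_point_comp_leP theta)/fuzzy_image_leP.
(* With [id] in place of [theta], membership of the fuzzy point in [c f] reduces to
   [c f x <= c f x]. *)
by apply: cont_x; apply/lefP; exact/(fuzzy_point_comp_leP id).
Qed.
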